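(* Let $D$ be a connected mixed graph and $\alpha\in\mathbb{C}$ with $|\alpha|=1$. Then $\rho_\alpha(D)=\Delta_{\Gamma(D)}$ if and only if $D$ is regular and is an $\alpha$-monograph of first kind or an $\alpha$-monograph of second kind.
   Context: A mixed graph $D$ is obtained from a finite simple undirected graph $\Gamma(D)$ by replacing some edges by arcs: between any two adjacent vertices $u,v$ there is exactly one of a digon $u\sim v$, an arc $u\to v$, or an arc $v\to u$; connectedness, regularity, cycles and the maximum degree $\Delta_{\Gamma(D)}$ refer to $\Gamma(D)$. For $|\alpha|=1$, $H^\alpha(D)=[h_{uv}]$ has $h_{uv}=1$ if $u\sim v$, $\alpha$ if $u\to v$, $\bar\alpha$ if $v\to u$, $0$ otherwise; $\rho_\alpha(D)$ is the largest modulus of an eigenvalue of $H^\alpha(D)$. A mixed walk $W=v_1,\dots,v_k$ has value $h_\alpha(W)=h_{v_1v_2}\cdots h_{v_{k-1}v_k}$ and $g_\alpha(W)=(-1)^{k+1}h_\alpha(W)$. For a cycle $C$ with vertices $v_1,\dots,v_\ell$ in cyclic order, a traversal $\vec C$ is the closed walk $v_1,\dots,v_\ell,v_1$ (either direction, any start). $D$ is an $\alpha$-monograph of first kind if $h_\alpha(\vec C)=1$ for all cycles $C$ and traversals $\vec C$, and of second kind if $g_\alpha(\vec C)=1$ (equivalently $h_\alpha(\vec C)=(-1)^\ell$ for a cycle of length $\ell$) for all cycles and traversals. *)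

(* Defs.v *)
From mathcomp Require Import all_boot all_order all_algebra.
From mathcomp Require Import classical_sets reals.
From mathcomp Require Import complex.

Set Implicit Arguments.
Unset Strict Implicit.
Unset Printing Implicit Defensive.

Import Order.TTheory GRing.Theory Num.Theory.

Local Open Scope ring_scope.

(* [adj] is the underlying simple graph; [arc u v] says that the edge {u, v}
   was replaced by the arc u -> v. The edges left unoriented are the digons. *)
Record mixed_graph (T : finType) := MixedGraph {
  adj : rel T;
  arc : rel T;
  adj_sym : symmetric adj;
  adj_irr : irreflexive adj;
  arc_adj : forall u v, arc u v -> adj u v;
  arc_asym : forall u v, arc u v -> ~~ arc v u
}.

Definition digon (T : finType) (D : mixed_graph T) : rel T :=
  fun u v => [&& adj D u v, ~~ arc D u v & ~~ arc D v u].

Definition connected_graph (T : finType) (D : mixed_graph T) : Prop :=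
  (0 < #|T|)%N /\ forall u v : T, connect (adj D) u v.

Definition degree (T : finType) (D : mixed_graph T) (v : T) : nat :=
  #|[set u | adj D v u]|.

Definition max_degree (T : finType) (D : mixed_graph T) : nat :=
  (\max_(v : T) degree D v)%N.

Definition regular (T : finType) (D : mixed_graph T) : Prop :=
  exists k : nat, forall v : T, degree D v = k.

Definition hentry (R : realType) (T : finType) (alpha : R[i])
    (D : mixed_graph T) (u v : T) : R[i] :=
  if digon D u v then 1
  else if arc D u v then alpha
  else if arc D v u then alpha^*%C
  else 0.

(* MathComp matrices are indexed by ordinals; the vertices are numbered by
   [enum_val], and the spectrum does not depend on the numbering. *)
Definition hmatrix (R : realType) (T : finType) (alpha : R[i])
    (D : mixed_graph T) : 'M[R[i]]_#|T| :=
  \matrix_(i, j) hentry alpha D (enum_val i) (enum_val j).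

(* The spectrum is finite, and nonempty when T is, so the supremum of the
   moduli is then their maximum. *)
Definition spectral_radius (R : realType) (T : finType) (alpha : R[i])
    (D : mixed_graph T) : R :=
  sup [set r : R | exists2 z : R[i],
         eigenvalue (hmatrix alpha D) z & r = ComplexField.Normc.normc z]%classic.

(* A walk is the sequence of its vertices. *)
Definition walk_h (R : realType) (T : finType) (alpha : R[i])
    (D : mixed_graph T) (W : seq T) : R[i] :=
  if W is x :: p then \prod_(z <- pairmap (hentry alpha D) x p) z else 1.

Definition walk_g (R : realType) (T : finType) (alpha : R[i])
    (D : mixed_graph T) (W : seq T) : R[i] :=
  (-1) ^+ (size W).+1 * walk_h alpha D W.

(* A cycle is given by its vertices in cyclic order. Every rotation and
   reversal of such a sequence is again one, so quantifying over sequences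
   covers all traversals (start and direction) of all cycles. *)
Definition is_cycle (T : finType) (D : mixed_graph T) (c : seq T) : bool :=
  [&& (2 < size c)%N, uniq c & cycle (adj D) c].

(* v_1, ..., v_l |-> v_1, ..., v_l, v_1 *)
Definition traversal (T : finType) (c : seq T) : seq T :=
  if c is x :: _ then rcons c x else [::].

Definition monograph1 (R : realType) (T : finType) (alpha : R[i])
    (D : mixed_graph T) : Prop :=
  forall c : seq T, is_cycle D c -> walk_h alpha D (traversal c) = 1.

Definition monograph2 (R : realType) (T : finType) (alpha : R[i])
    (D : mixed_graph T) : Prop :=
  forall c : seq T, is_cycle D c -> walk_g alpha D (traversal c) = 1.

(* Main.v *)
Require Import Defs.
From mathcomp Require Import all_boot all_order all_algebra.
From mathcomp Require Import classical_sets reals.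
From mathcomp Require Import complex.

Import Order.TTheory GRing.Theory Num.Theory.

Local Open Scope ring_scope.

(** An eigenvector [x] for an eigenvalue [z] with [|z| = Delta] forces equality
    in the triangle inequality at a vertex [u] where [|x|] is maximal: [u] has
    degree [Delta], and [x v * h v u = s * x u] for all neighbours [v] of [u],
    with [s = z / Delta]. Hence [|x|] is maximal at the neighbours too, and by
    connectedness everywhere. Going back and forth along an edge gives
    [s ^ 2 = 1], and going around a cycle [C] gives [h(C) = s ^ |C|]: the two
    signs are the two kinds of monographs. Conversely, if the gains [s * h]
    multiply to [1] around every cycle, they do so along every closed walk, so
    they are the quotients of a potential [x], which is an eigenvector for the
    eigenvalue [s * Delta] when the graph is regular. *)

(** * Gains of closed walks, and potentials *)

Lemma not_uniq_split (T : eqType) (p : seq T) : ~~ uniq p ->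
  exists p1 y p2 p3, p = p1 ++ y :: p2 ++ y :: p3.
Proof.
elim: p => //= x p IHp; rewrite negb_and negbK => /orP[/splitPr[p2 p3]|].
  by exists [::], x, p2, p3.
by case/IHp=> p1 [y [p2 [p3 ->]]]; exists (x :: p1), y, p2, p3.
Qed.

Section GainGraph.

Variables (F : fieldType) (T : finType) (e : rel T) (w : T -> T -> F).
Hypotheses (e_sym : symmetric e) (e_irr : irreflexive e).
Hypothesis w_inv : forall u v, e u v -> w u v * w v u = 1.

Definition gain (x : T) (p : seq T) : F := \prod_(z <- pairmap w x p) z.

Lemma gain_nil x : gain x [::] = 1.
Proof. by rewrite /gain big_nil. Qed.

Lemma gain_cons x y p : gain x (y :: p) = w x y * gain y p.
Proof. by rewrite /gain /= big_cons. Qed.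

Lemma gain_cat x p q : gain x (p ++ q) = gain x p * gain (last x p) q.
Proof. by rewrite /gain pairmap_cat big_cat. Qed.

Lemma gain_neq0 x p : path e x p -> gain x p != 0.
Proof.
elim: p x => [|y p IHp] x /=; first by rewrite gain_nil oner_neq0.
case/andP=> exy /IHp gp; rewrite gain_cons mulf_neq0 //.
by apply: contra_eq_neq (w_inv _ _ exy) => ->; rewrite mul0r eq_sym oner_neq0.
Qed.

Hypothesis cycle_gain : forall x p,
  (1 < size p)%N -> uniq (x :: p) -> path e x (rcons p x) ->
  gain x (rcons p x) = 1.

(** Strong induction on the length. Cutting out the loop between two visits to the same vertex
    leaves a shorter closed walk, and the loop itself is a shorter closed walk of gain 1. *)
Lemma closed_walk_gain x p : path e x p -> last x p = x -> gain x p = 1.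
Proof.
have [n] := ubnP (size p); elim: n x p => // n IHn x p /ltnSE-size_p e_p last_p.
(* The start [x] occurs in [p] only as its end, so a repetition-free [p] is empty, a step back and
   forth along an edge, or a cycle. *)
case: (boolP (uniq p)) => [|/not_uniq_split[p1 [y [p2 [p3 def_p]]]]].
  case/lastP: p => [|p y] in size_p e_p last_p *; first by rewrite gain_nil.
  move: last_p e_p; rewrite last_rcons => -> e_p; rewrite rcons_uniq => Up.
  case: p => [|y1 [|y2 p]] in size_p e_p Up *.
  - by move: e_p; rewrite /= e_irr.
  - by case/andP: e_p => exy _; rewrite !gain_cons gain_nil mulr1 w_inv.
  - exact: cycle_gain.
move: size_p e_p last_p; rewrite {}def_p !size_cat /= size_cat /=.
rewrite !addnS cat_path last_cat /= cat_path last_cat /=.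
move=> size_p /and5P[e_p1 e_y e_p2 e_y' e_p3] last_p3.
have loop : gain y (p2 ++ [:: y]) = 1.
  apply: IHn; last by rewrite last_cat.
    rewrite size_cat addn1; apply: leq_trans size_p.
    by rewrite !ltnS addnCA leq_addr.
  by rewrite cat_path /= e_p2 e_y'.
rewrite gain_cat gain_cons -cat_rcons -cats1 gain_cat loop mul1r last_cat /=.
rewrite -gain_cons -gain_cat; apply: IHn; last by rewrite last_cat.
  rewrite size_cat /= addnS; apply: leq_trans size_p.
  by rewrite !ltnS leq_add2l leq_addl.
by rewrite cat_path /= e_p1 e_y.
Qed.

(** The potential at [u] is the gain of a chosen walk from [r] to [u]. *)
Lemma gain_potential (r : T) : (forall u v, connect e u v) ->
  exists2 x : T -> F, x r != 0 & forall u v, e u v -> x u * w u v = x v.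
Proof.
move=> e_conn.
have walk u v : {p : seq T | path e u p & v == last u p}.
  by apply: sig2W; case/connectP: (e_conn u v) => p e_p /eqP; exists p.
exists (fun u => gain r (s2val (walk r u))).
  by apply: gain_neq0; case: (walk r r).
move=> u v euv.
case: (walk r u) (walk r v) (walk v r) => /= p e_p /eqP def_u [/= q e_q /eqP def_v].
(* A walk [t] from [v] back to [r] closes both walks to [v], the one through [u] and the chosen one;
   both closed walks have gain 1, and the nonzero gain of [t] cancels. *)
case=> t e_t /eqP def_r.
have gt_n0 := gain_neq0 _ _ e_t; apply: (mulIf gt_n0).
rewrite -mulrA -gain_cons {1}def_u -gain_cat def_v -gain_cat.
by rewrite !closed_walk_gain // ?cat_path ?last_cat -?def_u -?def_v /= ?e_p ?euv
           ?e_q -?def_r.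
Qed.

End GainGraph.

(** * Entries and eigenvectors of the Hermitian adjacency matrix *)

Section HermitianAdjacency.

Variables (R : realType) (T : finType) (D : mixed_graph T) (alpha : R[i]).
Hypothesis alpha_unit : `|alpha| = 1.

Local Notation h := (hentry alpha D).

Lemma hentry_non_adj u v : ~~ adj D u v -> h u v = 0.
Proof.
move=> n_uv; rewrite /hentry /digon (negPf n_uv) /=.
case: ifP => [/arc_adj|_]; first by rewrite (negPf n_uv).
by case: ifP => // /arc_adj; rewrite adj_sym (negPf n_uv).
Qed.

Lemma hentry_norm u v : adj D u v -> `|h u v| = 1.
Proof.
move=> uv; rewrite /hentry /digon uv /=.
case: (Defs.arc D u v) => //=; case: (Defs.arc D v u) => /=; rewrite ?normr1 //.
by rewrite normcJ.
Qed.

Lemma hentry_inv u v : adj D u v -> h u v * h v u = 1.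
Proof.
move=> uv; have alphaJ : alpha * alpha^*%C = 1.
  by rewrite -sqr_normc alpha_unit expr1n.
rewrite /hentry /digon uv adj_sym uv /= andbC.
case: (boolP (Defs.arc D u v)) => [/arc_asym/negPf -> //=|_] /=.
by case: (Defs.arc D v u) => /=; rewrite ?mulr1 // mulrC.
Qed.

(** Eigenvectors become functions on vertices, free of the numbering. They are row vectors, hence
    the order of the indices in [h v u]. *)
Lemma eigenvalue_hmatrixP z :
  eigenvalue (hmatrix alpha D) z <->
  exists2 x : T -> R[i], exists r, x r != 0 &
    forall u, \sum_(v | adj D u v) x v * h v u = z * x u.
Proof.
have sum_adj (x : T -> R[i]) u :
    \sum_(v | adj D u v) x v * h v u
    = \sum_(i < #|T|) x (enum_val i) * h (enum_val i) u.
  rewrite big_mkcond /= (reindex _ (onW_bij _ (enum_val_bij T))).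
  apply: eq_bigr => i _; case: ifPn => // n_uv.
  by rewrite hentry_non_adj ?mulr0 // adj_sym.
split=> [/eigenvalueP[x xA x_n0]|[x [r x_r] xA]].
  exists (fun u => x 0 (enum_rank u)).
    case/rV0Pn: x_n0 => i x_i; exists (enum_val i); by rewrite enum_valK.
  move=> u; have /rowP/(_ (enum_rank u)) := xA; rewrite !mxE => <-.
  by rewrite sum_adj; apply: eq_bigr => i _; rewrite mxE enum_valK enum_rankK.
apply/eigenvalueP; exists (\row_i x (enum_val i)).
  apply/rowP=> j; rewrite !mxE -xA sum_adj.
  by apply: eq_bigr => i _; rewrite !mxE.
by apply/rV0Pn; exists (enum_rank r); rewrite mxE enum_rankK.
Qed.

Lemma degreeE (A : nzSemiRingType) u :
  (degree D u)%:R = \sum_(v | adj D u v) 1 :> A.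
Proof. by rewrite sumr_const /degree cardsE. Qed.

Lemma degree_max u : (degree D u <= max_degree D)%N.
Proof. exact: leq_bigmax. Qed.

(** * The triangle inequality at a vertex of maximal modulus *)

Section MaximalModulus.

Variables (x : T -> R[i]) (z : R[i]) (u : T).
Hypotheses (xu_neq0 : x u != 0) (x_max : forall v, `|x v| <= `|x u|).
Hypothesis x_eigen : \sum_(v | adj D u v) x v * h v u = z * x u.

Lemma summand_le v : adj D u v -> `|x v * h v u| <= `|x u|.
Proof. by move=> uv; rewrite normrM hentry_norm ?mulr1 // adj_sym. Qed.

Lemma eigenvalue_le_degree : `|z| <= (degree D u)%:R.
Proof.
have xu_gt0 : 0 < `|x u| by rewrite normr_gt0.
rewrite -(ler_pM2r xu_gt0) -normrM -x_eigen degreeE mulr_suml.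
apply: le_trans (ler_norm_sum _ _ _) _; apply: ler_sum => v uv.
by rewrite mul1r summand_le.
Qed.

Lemma eigenvalue_eq_degree d : (degree D u <= d)%N -> `|z| = d%:R ->
  degree D u = d /\
  forall v, adj D u v -> x v * h v u = z / d%:R * x u.
Proof.
move=> deg_le z_d; have deg_u : degree D u = d.
  apply/eqP; rewrite eqn_leq deg_le -(ler_nat R[i]) -z_d.
  exact: eigenvalue_le_degree.
split=> // v uv.
have d_n0 : d%:R != 0 :> R[i].
  by rewrite pnatr_eq0 -lt0n -deg_u; apply/card_gt0P; exists v; rewrite inE.
have z_n0 : z != 0 by rewrite -normr_eq0 z_d.
(* The expected common value of the summands: their sum [z * x u] divided by their number. *)
set t := z / d%:R * x u.
have t_norm : `|t| = `|x u|.
  by rewrite /t !normrM z_d normfV normr_nat divff // mul1r.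
have t_n0 : t != 0 by rewrite -normr_eq0 t_norm normr_eq0.
have t_gt0 : 0 < `|t| by rewrite normr_gt0.
apply: (divIf t_n0); rewrite divff //.
(* Divided by [t], the [d] summands have modulus at most 1 and add up to [d], so each of them is
   1. *)
apply: (normC_sum_upper (G := fun=> 1) (P := adj D u)
         (F := fun v => x v * h v u / t)) => // [v1 uv1|].
  by rewrite normrM normfV ler_pdivrMr // mul1r t_norm summand_le.
rewrite -mulr_suml x_eigen -degreeE deg_u /t invfM invf_div.
by rewrite mulrACA divff // mulr1 mulrCA divff // mulr1.
Qed.

End MaximalModulus.

Lemma max_modulus (x : T -> R[i]) r : x r != 0 ->
  exists2 u, x u != 0 & forall v, `|x v| <= `|x u|.
Proof.
move=> x_r; case: (@real_arg_maxP _ T r xpredT (fun u => `|x u|)) => // [? _|u _ x_u].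
  exact: normr_real.
exists u; last by move=> v; apply: x_u.
by rewrite -normr_gt0 (lt_le_trans _ (x_u r isT)) ?normr_gt0.
Qed.

Lemma eigenvalue_le_max_degree z :
  eigenvalue (hmatrix alpha D) z -> `|z| <= (max_degree D)%:R.
Proof.
case/eigenvalue_hmatrixP=> x [r /max_modulus[u x_u x_max]] x_eigen.
apply: le_trans (eigenvalue_le_degree _ _ _ x_u x_max (x_eigen u)) _.
by rewrite ler_nat degree_max.
Qed.

(** * The spectral radius as an attained maximum *)

Lemma norm_normc (z : R[i]) : `|z| = (ComplexField.Normc.normc z)%:C%C.
Proof. by rewrite normc_def; case: z. Qed.

Lemma spectral_radius_max z : eigenvalue (hmatrix alpha D) z ->
  (forall y, eigenvalue (hmatrix alpha D) y -> `|y| <= `|z|) ->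
  `|z| = (spectral_radius alpha D)%:C%C.
Proof.
move=> z_eig z_max; rewrite norm_normc; congr (_%:C)%C.
rewrite /spectral_radius; set E := (X in sup X).
have E_z : E (ComplexField.Normc.normc z) by exists z.
have ubE : ubound E (ComplexField.Normc.normc z).
  by move=> _ [y /z_max le_yz ->]; rewrite -lecR -!norm_normc.
apply/le_anti/andP; split; last first.
  by apply: ge_sup => //; exists (ComplexField.Normc.normc z).
by apply: ub_le_sup => //; exists (ComplexField.Normc.normc z).
Qed.

(** The characteristic polynomial splits over [R[i]] and has positive degree, so the eigenvalues
    form a finite nonempty list, which has a member of largest modulus. *)
Lemma spectral_radius_attained : (0 < #|T|)%N ->
  exists2 z, eigenvalue (hmatrix alpha D) z &
    `|z| = (spectral_radius alpha D)%:C%C.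
Proof.
move=> T_gt0.
have [rs def_p] := closed_field_poly_normal (char_poly (hmatrix alpha D)).
have eig_rs z : eigenvalue (hmatrix alpha D) z = (z \in rs).
  rewrite eigenvalue_root_char def_p (monicP (char_poly_monic _)) scale1r.
  exact: root_prod_XsubC.
have rs_gt0 : (0 < size rs)%N.
  have := size_char_poly (hmatrix alpha D).
  rewrite def_p (monicP (char_poly_monic _)) scale1r size_prod_XsubC => -[->].
  exact: T_gt0.
pose f (i : 'I_(size rs)) := `|rs`_i|.
case: (@real_arg_maxP _ _ (Ordinal rs_gt0) xpredT f) => // [? _|i _ i_max].
  exact: normr_real.
have eig_i : eigenvalue (hmatrix alpha D) rs`_i by rewrite eig_rs mem_nth.
exists rs`_i => //; apply: spectral_radius_max => // y.
rewrite eig_rs => /(nthP 0)[j lt_j <-]; exact: (i_max (Ordinal lt_j)).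
Qed.

(** * Monographs and eigenvalues of modulus [max_degree D] *)

Lemma gain_walk_h (s : R[i]) x p :
  gain R[i] T (fun u v => s * h u v) x p
  = s ^+ size p * walk_h alpha D (x :: p).
Proof.
elim: p x => [|y p IHp] x; first by rewrite gain_nil /= big_nil mulr1.
by rewrite gain_cons IHp /= big_cons exprS mulrACA.
Qed.

(* [walk_g] counts the vertices of the walk: a cycle of length [l] is traversed
   by [l + 1] vertices, so its sign [(-1) ^ (l + 2)] is [(-1) ^ l]. *)
Lemma monographP :
  monograph1 alpha D \/ monograph2 alpha D <->
  exists2 s : R[i], s ^+ 2 = 1 &
    forall x p, is_cycle D (x :: p) ->
      s ^+ (size p).+1 * walk_h alpha D (x :: rcons p x) = 1.
Proof.
have sizeS (x : T) p : (size (x :: rcons p x)).+1 = ((size p).+1 + 2)%N.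
  by rewrite /= size_rcons addn2.
split=> [[mono|mono]|[s /eqP]].
- by exists 1; [rewrite expr1n|move=> x p /mono /= ->; rewrite expr1n mulr1].
- exists (-1); first by rewrite sqrrN expr1n.
  move=> x p /mono; rewrite /walk_g [traversal _]/= sizeS exprD sqrrN expr1n.
  by rewrite mulr1.
rewrite sqrf_eq1 => /orP[]/eqP-> mono; [left|right] => -[//|x p] /mono.
  by rewrite expr1n mul1r.
by rewrite /walk_g [traversal _]/= sizeS exprD sqrrN expr1n mulr1.
Qed.

Lemma monograph_eigenvalue d (s : R[i]) (r : T) :
    (forall u v, connect (adj D) u v) ->
    (forall u, degree D u = d) -> s ^+ 2 = 1 ->
    (forall x p, is_cycle D (x :: p) ->
      s ^+ (size p).+1 * walk_h alpha D (x :: rcons p x) = 1) ->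
  eigenvalue (hmatrix alpha D) (s * d%:R).
Proof.
move=> conn deg ss mono; apply/eigenvalue_hmatrixP.
have [||x p size_p Uxp e_p||x x_r x_pot] :=
  @gain_potential R[i] T (adj D) (fun u v => s * h u v) _ _ _ r.
- exact: adj_irr.
- by move=> u v uv; rewrite mulrACA hentry_inv // mulr1 -expr2.
- rewrite gain_walk_h size_rcons; apply: mono.
  by rewrite /is_cycle Uxp /= ltnS size_p.
- exact: conn.
exists x; first by exists r.
move=> u; rewrite -mulrA -(deg u) degreeE mulr_suml mulr_sumr.
apply: eq_bigr => v uv; rewrite mul1r -(x_pot v u) 1?adj_sym //.
(* The potential gives [x v * (s * h v u) = x u]; since [s ^ 2 = 1], each summand [x v * h v u] is
   [s * x u]. *)
by rewrite [RHS]mulrCA [s * (s * _)]mulrA -expr2 ss mul1r.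
Qed.

Lemma max_degree_eigenvalue z :
    (forall u v, connect (adj D) u v) ->
    eigenvalue (hmatrix alpha D) z -> `|z| = (max_degree D)%:R ->
  regular D /\ (monograph1 alpha D \/ monograph2 alpha D).
Proof.
move=> conn /eigenvalue_hmatrixP[x [r /max_modulus[u x_u u_max]] x_eig] z_max.
set d := max_degree D in z_max *.
have local v (vmax : `|x v| = `|x u|) : degree D v = d /\
    forall t, adj D v t -> x t * h t v = z / d%:R * x v.
  apply: eigenvalue_eq_degree => //; last exact: degree_max.
    by rewrite -normr_eq0 vmax normr_eq0.
  by move=> t; rewrite vmax.
have x_norm v : `|x v| = `|x u|.
  (* Maximality of the modulus spreads along a walk from [u], since [local] applies at each vertex
     reached. *)
  have /connectP[p e_p ->] := conn u v.
  elim/last_ind: p e_p => //= p t IHp; rewrite rcons_path last_rcons.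
  case/andP=> /IHp pmax e_t.
  have [deg /(_ t e_t)/(congr1 Num.norm)] := local _ pmax.
  rewrite !normrM hentry_norm 1?adj_sym // mulr1 z_max normfV normr_nat pmax.
  rewrite divff ?mul1r // pnatr_eq0 -lt0n -deg.
  by apply/card_gt0P; exists t; rewrite inE.
set s := z / d%:R in local.
have step v t : adj D v t -> x t * h t v = s * x v.
  by case: (local v (x_norm v)) => _; apply.
have x_n0 v : x v != 0 by rewrite -normr_eq0 x_norm normr_eq0.
split; first by exists d => v; case: (local v (x_norm v)).
apply/monographP.
(* If [u] has no neighbour, then [d = 0] and [s = z / 0 = 0] is not a sign; but then [u] is the only
   vertex, there is no cycle, and the sign 1 serves. *)
case: (pickP (fun t => adj D u t)) => [t ut|no_adj]; last first.
  exists 1 => [|y p]; first by rewrite expr1n.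
  case/and3P=> _ _; rewrite /cycle.
  have /connectP[[|q1 q]] := conn u y; last by rewrite /= no_adj.
  by move=> _ ->; case: p => [|p1 p] /=; rewrite no_adj.
have ss : s ^+ 2 = 1.
  apply: (mulIf (x_n0 u)); rewrite expr2 -mulrA -(step u t ut) mulrA.
  by rewrite -(step t u) 1?adj_sym // -mulrA hentry_inv ?mulr1 ?mul1r.
exists s => // y p /and3P[_ _ cyc].
have walk v q : path (adj D) v q ->
    x v * walk_h alpha D (v :: q) = s ^+ size q * x (last v q).
  elim: q v => [|t1 q IHq] v /=; first by rewrite big_nil mulr1 mul1r.
  case/andP=> vt /IHq walk_q; rewrite big_cons mulrA step 1?adj_sym //.
  by rewrite -mulrA walk_q mulrA -exprS.
(* Around the cycle [x y] cancels, so [walk_h] is [s ^ l] with [l] the length; the product with the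
   other factor [s ^ l] is a power of [s ^ 2]. *)
have := walk y _ cyc; rewrite size_rcons last_rcons mulrC => /(mulIf (x_n0 y)) ->.
by rewrite -exprD addnn -mul2n exprM ss expr1n.
Qed.

End HermitianAdjacency.

Theorem theorem6p1 (R : realType) (T : finType) (D : mixed_graph T)
    (alpha : R[i]) (D_connected : connected_graph D)
    (alpha_unit : `|alpha| = 1) :
  spectral_radius alpha D = (max_degree D)%:R
  <-> regular D /\ (monograph1 alpha D \/ monograph2 alpha D).
Proof.
have [T_gt0 conn] := D_connected; split=> [rho|[[d deg] /monographP[s ss mono]]].
  have [z z_eig z_rho] := spectral_radius_attained R T D alpha T_gt0.
  apply: (max_degree_eigenvalue _ _ _ _ alpha_unit z) => //.
  by rewrite z_rho rho rmorph_nat.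
have /card_gt0P[r _] := T_gt0.
have max_d : max_degree D = d.
  apply/eqP; rewrite eqn_leq -{2}(deg r) degree_max andbT.
  by apply/bigmax_leqP => u _; rewrite deg.
have eig : eigenvalue (hmatrix alpha D) (s * d%:R) by apply: monograph_eigenvalue.
have s_norm : `|s| = 1.
  by apply/eqP; rewrite -(@eqrXn2 _ 2) // -normrX ss normr1 expr1n.
have norm_sd : `|s * d%:R| = (max_degree D)%:R.
  by rewrite normrM s_norm mul1r normr_nat max_d.
(* No eigenvalue exceeds [max_degree D] in modulus, so [s * d] attains the spectral radius. *)
have := spectral_radius_max _ _ _ _ _ eig; rewrite norm_sd => sr.
apply: (@complexI R); rewrite rmorph_nat -sr // => y.
exact: eigenvalue_le_max_degree.
Qed.
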